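(* Let $(\mu_1,\mu_2)$ be a perfect system of two positive measures on $\mathbb{R}$, let $N\geq 2$, and let $P_N$ be the monic type II multiple orthogonal polynomial of degree $N$ on the stepline. Assume that its zeros $x_{1,N},\ldots,x_{N,N}$ (the quadrature nodes for simultaneous Gaussian quadrature) are pairwise distinct. Then the quadrature nodes $\{x_{j,N} : 1\leq j\leq N\}$ are given by the eigenvalues of the banded Hessenberg matrix $H_N$. Moreover, for $1\leq j\leq N$, let $\vec v_{N,j}$ be the right eigenvector of $H_N$ for the eigenvalue $x_{j,N}$ with first component $1$, and let $\vec u_{N,j}$ be a left eigenvector of $H_N$ for the eigenvalue $x_{j,N}$. Then the quadrature weights are $$\lambda_{j,N}^{(1)}=\frac{D_{1,1}\,\vec u_{N,j}(1)}{\langle \vec u_{N,j},\vec v_{N,j}\rangle},\qquad \lambda_{j,N}^{(2)}=\frac{D_{2,1}\,\vec u_{N,j}(1)+D_{2,2}\,\vec u_{N,j}(2)}{\langle \vec u_{N,j},\vec v_{N,j}\rangle},$$ where the constants $D_{i,j}$ are given by $$\begin{pmatrix} D_{1,1} & 0\\ D_{2,1} & D_{2,2}\end{pmatrix}=\begin{pmatrix} A_1 & 0\\ A_2 & B_2\end{pmatrix}^{-1},$$ and $A_1,A_2,B_2$ are the (constant) normalized type I multiple orthogonal polynomials on the stepline.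
   Context: Let $\mu_1,\mu_2$ be positive measures on $\mathbb{R}$ with all moments finite. Type II: for $(n,m)\in\mathbb{N}^2$ (with $0\in\mathbb{N}$), a type II multiple orthogonal polynomial $P_{n,m}$ is a nonzero polynomial of degree $\leq n+m$ with $\int P_{n,m}(x)x^k\,d\mu_1(x)=0$ for $0\leq k\leq n-1$ and $\int P_{n,m}(x)x^k\,d\mu_2(x)=0$ for $0\leq k\leq m-1$. Type I: for $(n,m)\neq(0,0)$, type I multiple orthogonal polynomials are a nonzero pair $(A_{n,m},B_{n,m})$ with $\deg A_{n,m}\leq n-1$, $\deg B_{n,m}\leq m-1$ (a polynomial of degree $\leq -1$ is $0$) and $\int A_{n,m}(x)x^k\,d\mu_1(x)+\int B_{n,m}(x)x^k\,d\mu_2(x)=0$ for $0\leq k\leq n+m-2$. A multi-index is normal if the type I and type II polynomials are unique up to a multiplicative factor; then $P_{n,m}$ has degree exactly $n+m$ and is taken monic, and the type I polynomials are normalized by $\int x^{n+m-1}A_{n,m}(x)\,d\mu_1(x)+\int x^{n+m-1}B_{n,m}(x)\,d\mu_2(x)=1$. The system $(\mu_1,\mu_2)$ is perfect if all multi-indices are normal. Stepline notation: $P_{2k}=P_{k,k}$, $P_{2k+1}=P_{k+1,k}$, $A_{2k}=A_{k,k}$, $A_{2k+1}=A_{k+1,k}$, $B_{2k}=B_{k,k}$, $B_{2k+1}=B_{k+1,k}$. In particular $A_1=A_{1,0}$, $A_2=A_{1,1}$, $B_2=B_{1,1}$ are constants and $B_1=B_{1,0}=0$. The stepline polynomials satisfy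 a four-term recurrence $xP_n(x)=P_{n+1}(x)+b_nP_n(x)+c_nP_{n-1}(x)+d_nP_{n-2}(x)$, $n\geq 0$ (with $P_{-1}=P_{-2}=0$), which defines the coefficients $b_n$ ($n\ge0$), $c_n$ ($n\ge1$), $d_n$ ($n\ge2$). The banded Hessenberg matrix $H_N$ is the $N\times N$ matrix with entries $(H_N)_{i,i}=b_{i-1}$, $(H_N)_{i,i+1}=1$, $(H_N)_{i+1,i}=c_i$, $(H_N)_{i+2,i}=d_{i+1}$, and all other entries $0$. Simultaneous Gaussian quadrature with $N$ nodes: the nodes are the zeros $x_{1,N},\ldots,x_{N,N}$ of $P_N$, and the quadrature is interpolatory, $\int f\,d\mu_i\approx\sum_{j=1}^N\lambda_{j,N}^{(i)}f(x_{j,N})$, with weights $$\lambda_{j,N}^{(i)}=\int_{\mathbb{R}}\frac{P_N(x)}{(x-x_{j,N})P_N'(x_{j,N})}\,d\mu_i(x),\qquad i=1,2.$$ A right eigenvector $\vec v$ satisfies $H_N\vec v=x\vec v$ (column vector), a left eigenvector $\vec u$ satisfies $\vec uH_N=x\vec u$ (row vector), both nonzero; $\vec u(k)$ denotes the $k$-th component, and $\langle\vec u,\vec v\rangle=\sum_{k=1}^N\vec u(k)\vec v(k)$ (no complex conjugation). *)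

(* Defs.v *)
(* Built on MathComp, with MathComp-Analysis for measures and integrals and
   real-closed for the complex numbers R[i]. *)
From HB Require Import structures.
From mathcomp Require Import all_boot all_order all_algebra.
From mathcomp Require Import all_classical all_reals all_analysis.
From mathcomp Require Import complex.

Set Implicit Arguments.
Unset Strict Implicit.
Unset Printing Implicit Defensive.

Import Order.TTheory GRing.Theory Num.Theory.

Local Open Scope classical_set_scope.
Local Open Scope complex_scope.
Local Open Scope ring_scope.

Section MultipleOrthogonality.
Context {R : realType}.

Notation borel_measure := {measure set (measurableTypeR R) -> \bar R}.

Definition finite_moments (mu : borel_measure) : Prop :=
  forall k : nat, mu.-integrable setT (fun x : measurableTypeR R => (x ^+ k)%:E).

Definition pint (mu : borel_measure) (p : {poly R}) : R :=
  (\int[mu]_(x in setT) p.[x])%R.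

Definition unique_up_to_factor (V : lmodType R) (S : V -> Prop) : Prop :=
  exists2 v, S v & forall w, S w -> exists c : R, w = c *: v.

Context (mu1 mu2 : borel_measure).

Definition typeII (n m : nat) (P : {poly R}) : Prop :=
  [/\ P != 0,
      (size P <= (n + m).+1)%N,
      forall k, (k < n)%N -> pint mu1 (P * 'X^k) = 0
    & forall k, (k < m)%N -> pint mu2 (P * 'X^k) = 0].

(* The orthogonality range 0 <= k <= n + m - 2 is written k + 1 < n + m, so that
   it is empty when n + m = 1. *)
Definition typeI (n m : nat) (AB : {poly R} * {poly R}) : Prop :=
  [/\ AB != (0, 0),
      (size AB.1 <= n)%N,
      (size AB.2 <= m)%N
    & forall k, (k.+1 < n + m)%N ->
        pint mu1 (AB.1 * 'X^k) + pint mu2 (AB.2 * 'X^k) = 0].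

(* Uniqueness up to a factor does not by itself force deg P = n + m (e.g. at
   (1,1), when mu1 and mu2, once normalized, have equal means but different
   second moments), so the exact degree, needed for the monic normalization, is
   part of normality.  It also makes the type I normalization below possible. *)
Definition normal_index (n m : nat) : Prop :=
  [/\ unique_up_to_factor (typeII n m),
      forall P, typeII n m P -> size P = (n + m).+1
    & (0 < n + m)%N -> unique_up_to_factor (typeI n m)].

Definition perfect : Prop := forall n m : nat, normal_index n m.

Definition typeII_poly (n m : nat) : {poly R} :=
  xget 0 [set P | typeII n m P /\ P \is monic].

Definition typeI_polys (n m : nat) : {poly R} * {poly R} :=
  xget (0, 0) [set AB | typeI n m AB /\
    pint mu1 ('X^((n + m).-1) * AB.1) + pint mu2 ('X^((n + m).-1) * AB.2) = 1].

(* On the stepline, 2k stands for (k, k) and 2k+1 for (k+1, k). *)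
Definition stepP (n : nat) : {poly R} := typeII_poly (uphalf n) n./2.
Definition stepA (n : nat) : {poly R} := (typeI_polys (uphalf n) n./2).1.
Definition stepB (n : nat) : {poly R} := (typeI_polys (uphalf n) n./2).2.

(* P_(n-k), with the convention that it is 0 for a negative index *)
Definition stepP_back (n k : nat) : {poly R} :=
  if (k <= n)%N then stepP (n - k) else 0.

(* (b_n, c_n, d_n); the values c_0, d_0 and d_1 are arbitrary. *)
Definition rec_coefs (n : nat) : R * R * R :=
  xget (0, 0, 0) [set bcd : R * R * R |
    'X * stepP n = stepP n.+1 + bcd.1.1 *: stepP n
                   + bcd.1.2 *: stepP_back n 1 + bcd.2 *: stepP_back n 2].

Definition rec_b (n : nat) : R := (rec_coefs n).1.1.
Definition rec_c (n : nat) : R := (rec_coefs n).1.2.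
Definition rec_d (n : nat) : R := (rec_coefs n).2.

(* Indices start at 0 here. *)
Definition hessenberg (N : nat) : 'M[R]_N :=
  \matrix_(i < N, j < N)
    if j == i :> nat then rec_b i
    else if j == i.+1 :> nat then 1
    else if i == j.+1 :> nat then rec_c i
    else if i == j.+2 :> nat then rec_d i
    else 0.

(* [[A_1, 0], [A_2, B_2]]; these type I polynomials are constants. *)
Definition typeI_mx : 'M[R]_2 :=
  \matrix_(i < 2, j < 2)
    if i == 0 then (if j == 0 then (stepA 1)`_0 else 0)
    else (if j == 0 then (stepA 2)`_0 else (stepB 2)`_0).

End MultipleOrthogonality.

(* The zeros of P_N may be non-real, so the spectral side lives over R[i]. *)
Section Quadrature.
Context {R : realType}.

Definition toC_poly (p : {poly R}) : {poly R[i]} := map_poly (real_complex R) p.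

Definition cintegral (mu : {measure set (measurableTypeR R) -> \bar R})
    (f : R -> R[i]) : R[i] :=
  (\int[mu]_(x in setT) complex.Re (f x))%R
    +i* (\int[mu]_(x in setT) complex.Im (f x))%R.

(* P(x) / (x - z) is the polynomial quotient, so that the integrand is also
   correct at x = z when z is real (mu may have an atom there). *)
Definition quad_weight (mu : {measure set (measurableTypeR R) -> \bar R})
    (P : {poly R[i]}) (z : R[i]) : R[i] :=
  cintegral mu (fun x : R => (P %/ ('X - z%:P)).[x%:C] / (P^`()).[z]).

Definition right_eigenvector (N : nat) (H : 'M[R[i]]_N) (z : R[i])
    (v : 'cV[R[i]]_N) : Prop := H *m v = z *: v /\ v != 0.

Definition left_eigenvector (N : nat) (H : 'M[R[i]]_N) (z : R[i])
    (u : 'rV[R[i]]_N) : Prop := u *m H = z *: u /\ u != 0.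

Definition pairing (N : nat) (u : 'rV[R[i]]_N) (v : 'cV[R[i]]_N) : R[i] :=
  \sum_(k < N) u 0 k * v k 0.

End Quadrature.

(* Main.v *)
(* Put v_j = (P_k(x_j))_k.  The recurrence gives H_N v_j = x_j v_j, because the
   only defect, P_N(x_j) in the last row, vanishes at a node.  The coefficients
   C_jk of the Lagrange polynomial l_j in the basis P_0, ..., P_(N-1) form the
   inverse of the matrix V with columns v_j, so a left eigenvector u for x_j is
   <u, v_j> times the row C_j.  Integrating l_j = sum_k C_jk P_k against mu_i,
   orthogonality leaves only k = 0 for mu_1 and k = 0, 1 for mu_2, and the
   surviving integrals of P_0 and P_1 are the entries of D. *)
Require Import Defs.
From HB Require Import structures.
From mathcomp Require Import all_boot all_order all_algebra.
From mathcomp Require Import all_classical all_reals all_analysis.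
From mathcomp Require Import complex zify ring.

Set Implicit Arguments.
Unset Strict Implicit.
Unset Printing Implicit Defensive.

Import Order.TTheory GRing.Theory Num.Theory.

Local Open Scope classical_set_scope.
Local Open Scope complex_scope.
Local Open Scope ring_scope.

(** * Integration of polynomials as a linear functional *)

Section MomentFunctional.
Context {R : realType} (mu : {measure set (measurableTypeR R) -> \bar R}).
Context (hmom : finite_moments mu).

Lemma integrable_horner (p : {poly R}) :
  mu.-integrable setT (EFin \o (fun x : measurableTypeR R => p.[x])).
Proof.
have -> : EFin \o (fun x : measurableTypeR R => p.[x]) =
    (fun x : measurableTypeR R => \sum_(i < size p) (p`_i)%:E * (x ^+ i)%:E)%E.
  apply/funext => x /=; rewrite horner_coef -sumEFin.
  by apply: eq_bigr => i _; rewrite EFinM.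
apply: integrable_sum => // i _.
by apply: integrableZl => //; exact: hmom.
Qed.

Lemma pint_is_linear : linear_for *%R (pint mu).
Proof.
move=> a p q; rewrite /pint.
under eq_Rintegral do rewrite hornerD hornerZ.
rewrite RintegralD //; last 2 first.
- have := integrable_horner (a *: p).
  by congr (_.-integrable _ _); apply/funext => x /=; rewrite hornerZ.
- exact: integrable_horner.
by rewrite RintegralZl //; exact: integrable_horner.
Qed.

Lemma pintD (p q : {poly R}) : pint mu (p + q) = pint mu p + pint mu q.
Proof. by have := pint_is_linear 1 p q; rewrite scale1r mul1r. Qed.

Lemma pint0 : pint mu 0 = 0.
Proof. by apply: (addrI (pint mu 0)); rewrite -pintD !addr0. Qed.

Lemma pintZ (a : R) (p : {poly R}) : pint mu (a *: p) = a * pint mu p.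
Proof. by have := pint_is_linear a p 0; rewrite pint0 !addr0. Qed.

Lemma cintegral_toC_sum (n : nat) (c : 'I_n -> R[i]) (p : 'I_n -> {poly R}) :
  cintegral mu (fun x => (\sum_(k < n) c k *: toC_poly (p k)).[x%:C]) =
  \sum_(k < n) c k * (pint mu (p k))%:C.
Proof.
(* Real and imaginary parts are treated together: [f] stands for either one, additive and compatible
   with real factors, so it passes through to the coefficients [c k] and leaves the integral of a
   real polynomial. *)
have part (f : R[i] -> R) : {morph f : u v / u + v} -> f 0 = 0 ->
    (forall u r, f (u * r%:C) = f u * r) ->
  (\int[mu]_(x in setT)
     f (\sum_(k < n) c k *: toC_poly (p k)).[x%:C])%R =
  f (\sum_(k < n) c k * (pint mu (p k))%:C).
  move=> fD f0 fM.
  rewrite (big_morph f fD f0); under eq_bigr do rewrite fM -pintZ.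
  rewrite -(big_morph (pint mu) pintD pint0) /pint; apply: eq_Rintegral => x _.
  rewrite !horner_sum (big_morph f fD f0); apply: eq_bigr => k _.
  by rewrite !hornerZ /toC_poly horner_map fM.
rewrite /cintegral !part //.
- by case: (\sum_(k < n) _).
- by case=> ? ? [].
- by case=> a b r /=; rewrite mulr0 add0r.
- by case=> ? ? [].
- by case=> a b r /=; rewrite mulr0 subr0.
Qed.
End MomentFunctional.

(** * Eigenvectors of a matrix diagonalized with distinct eigenvalues *)

Section Diagonalization.
Context (F : fieldType) (n : nat) (x : 'I_n -> F) (H V C : 'M[F]_n).
Context (xI : injective x) (CV : C *m V = 1%:M).
Context (HV : forall i j, (H *m V) i j = x j * V i j).

Let VC : V *m C = 1%:M := mulmx1C CV.

Lemma diagonalizedE : H *m V = V *m diag_mx (\row_j x j).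
Proof. by apply/matrixP => i j; rewrite HV mul_mx_diag !mxE mulrC. Qed.

(** Multiplying by [V] turns [H] into a diagonal matrix, so coordinate [i] of [u *m V] is scaled
    both by [z] and by [x i]. *)
Lemma left_eigen_coords (z : F) (u : 'rV[F]_n) :
  u *m H = z *: u -> forall i, (u *m V) 0 i != 0 -> z = x i.
Proof.
move=> uH i; have : (u *m H *m V) 0 i = (z *: u *m V) 0 i by rewrite uH.
rewrite -mulmxA diagonalizedE mulmxA mul_mx_diag -scalemxAl.
rewrite [LHS]mxE [RHS]mxE [X in _ * X]mxE mulrC => e uVi.
exact: (mulIf uVi).
Qed.

(** Expand [u] as [(u *m V) *m C]; since the [x i] are distinct, only coordinate [j] of [u *m V] can
    be nonzero. *)
Lemma left_eigen_row (j : 'I_n) (u : 'rV[F]_n) :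
  u *m H = x j *: u -> forall k, u 0 k = (u *m V) 0 j * C j k.
Proof.
move=> uH k; rewrite -[in LHS](mulmx1 u) -VC mulmxA mxE (bigD1 j) //=.
rewrite big1 ?addr0 // => i ij; case: (eqVneq ((u *m V) 0 i) 0) => [->|].
  by rewrite mul0r.
by move=> /(left_eigen_coords uH)/xI ji; rewrite ji eqxx in ij.
Qed.

(** The dual argument: [C *m H] is the diagonal matrix times [C], so only coordinate [j] of [C *m v]
    survives. *)
Lemma right_eigen_col (j : 'I_n) (v : 'cV[F]_n) :
  H *m v = x j *: v -> forall k, v k 0 = V k j * (C *m v) j 0.
Proof.
have CH : C *m H = diag_mx (\row_j x j) *m C.
  by rewrite -[C *m H]mulmx1 -VC !mulmxA -(mulmxA C)
    diagonalizedE mulmxA CV mul1mx.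
move=> Hv k; rewrite -[in LHS](mul1mx v) -VC -mulmxA mxE (bigD1 j) //=.
rewrite big1 ?addr0 // => i ij; suff -> : (C *m v) i 0 = 0 by rewrite mulr0.
have : (C *m (H *m v)) i 0 = x j * (C *m v) i 0.
  by rewrite Hv -scalemxAr [LHS]mxE.
rewrite mulmxA CH -mulmxA mul_diag_mx [LHS]mxE [X in X * _]mxE => /eqP.
rewrite -subr_eq0 -mulrBl.
by rewrite mulf_eq0 subr_eq0 (inj_eq xI) (negPf ij) => /eqP.
Qed.

(** [eigenvalue] is defined by row vectors, so the witness for [x j] is row [j] of [C]. Conversely,
    [u *m V] has a nonzero coordinate because [V] is invertible. *)
Lemma diagonalized_eigenvalue (z : F) :
  eigenvalue H z <-> exists j, z = x j.
Proof.
split=> [/eigenvalueP[u uH u0]|[j ->]].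
  have /rV0Pn[i uVi] : u *m V != 0.
    apply: contra u0 => /eqP uV0.
    by rewrite -(mulmx1 u) -VC mulmxA uV0 mul0mx.
  by exists i; exact: left_eigen_coords uH _ uVi.
have [_ Vu] := mulmx1_unit CV.
apply/eigenvalueP; exists (row j C).
  apply: (can_inj (mulmxK Vu)); rewrite -mulmxA diagonalizedE.
  rewrite -scalemxAl -!row_mul mulmxA CV mul_mx_diag; apply/rowP => i.
  by rewrite !mxE; case: eqVneq => [->|_]; rewrite ?mulr1 ?mul1r ?mulr0 ?mul0r.
apply/eqP => /(congr1 (mulmx^~ V)); rewrite -row_mul CV mul0mx.
by move/rowP/(_ j)/eqP; rewrite !mxE eqxx oner_eq0.
Qed.
End Diagonalization.

(** * Expansion in a sequence of monic polynomials *)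

Lemma size_sub_monic (F : fieldType) (m : nat) (p q : {poly F}) :
  (size p <= m.+1)%N -> q \is monic -> size q = m.+1 ->
  (size (p - p`_m *: q)%R <= m)%N.
Proof.
move=> sp /monicP; rewrite lead_coefE => + sq; rewrite sq /= => qm.
apply/leq_sizeP => i mi; rewrite coefB coefZ.
have [->|im] := eqVneq i m; first by rewrite qm mulr1 subrr.
have {}mi : (m < i)%N by rewrite ltn_neqAle eq_sym im.
by rewrite [p`_i]nth_default ?(leq_trans sp) //
  [q`_i]nth_default ?sq // mulr0 subrr.
Qed.

Lemma monic_expansion (F : fieldType) (P : nat -> {poly F}) (n : nat) (q : {poly F}) :
  (forall k, P k \is monic /\ size (P k) = k.+1) -> (size q <= n)%N ->
  exists c : 'I_n -> F, q = \sum_(k < n) c k *: P k.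
Proof.
move=> hP; elim: n q => [|n IH] q sq.
  exists (fun=> 0); rewrite big_ord0; apply/eqP.
  by rewrite -size_poly_eq0 -leqn0.
have [Pm Ps] := hP n; have [c cE] := IH _ (size_sub_monic sq Pm Ps).
(* [insub] fails exactly at the last index, which receives the degree [n] coefficient of [q]. *)
exists (fun k : 'I_n.+1 => if insub (k : nat) is Some i then c i else q`_n).
rewrite big_ord_recr /= insubF ?ltnn //.
rewrite -[LHS](subrK (q`_n *: P n)) cE; congr (_ + _).
by apply: eq_bigr => i _; rewrite valK.
Qed.

(** * Lagrange polynomials at distinct nodes *)

Section Lagrange.
Context (F : fieldType) (n : nat) (x : 'I_n -> F) (P : {poly F}).
Context (PE : P = \prod_(j < n) ('X - (x j)%:P)) (xI : injective x).

Lemma lagrange_quotient (j : 'I_n) :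
  P %/ ('X - (x j)%:P) = \prod_(i < n | i != j) ('X - (x i)%:P).
Proof. by rewrite PE (bigD1 j) //= mulrC mulpK ?polyXsubC_eq0. Qed.

Lemma lagrange_size (j : 'I_n) : (size (P %/ ('X - (x j)%:P))%R <= n)%N.
Proof.
rewrite size_divp ?polyXsubC_eq0 // size_XsubC PE.
by rewrite -big_enum size_prod_XsubC size_enum_ord subn1.
Qed.

Lemma lagrange_horner (i j : 'I_n) :
  (P %/ ('X - (x j)%:P)).[x i] / P^`().[x j] = (i == j)%:R.
Proof.
have qi k : (P %/ ('X - (x j)%:P)).[x k] = \prod_(l < n | l != j) (x k - x l).
  by rewrite lagrange_quotient horner_prod;
  apply: eq_bigr => l _; rewrite hornerXsubC.
have -> : P^`().[x j] = (P %/ ('X - (x j)%:P)).[x j].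
  have -> : P^`() = ((P %/ ('X - (x j)%:P)) * ('X - (x j)%:P))^`().
    by rewrite lagrange_quotient PE [in LHS](bigD1 j) //= mulrC.
  by rewrite derivM derivXsubC mulr1 hornerD hornerM hornerXsubC subrr mulr0 add0r.
have [->|ij] := eqVneq i j; last by rewrite qi (bigD1 i) //= subrr mul0r mul0r.
rewrite divff // qi; apply/prodf_neq0 => l lj.
by rewrite subr_eq0 (inj_eq xI) eq_sym.
Qed.
End Lagrange.

(** * Orthogonality and recurrence on the stepline *)

Section Stepline.
Context {R : realType} (mu1 mu2 : {measure set (measurableTypeR R) -> \bar R}).
Context (hmom1 : finite_moments mu1) (hmom2 : finite_moments mu2).
Context (hperf : perfect mu1 mu2).

Local Notation L1 := (pint mu1).
Local Notation L2 := (pint mu2).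
Local Notation P := (stepP mu1 mu2).

(** The type II conditions without the nonvanishing and degree clauses, so that they are stable
    under linear combinations. *)
Definition step_orth (n : nat) (Q : {poly R}) : Prop :=
  (forall k, (k < uphalf n)%N -> L1 (Q * 'X^k) = 0) /\
  (forall k, (k < n./2)%N -> L2 (Q * 'X^k) = 0).

Lemma step_orth_scale_add (n : nat) (a : R) (Q S : {poly R}) :
  step_orth n Q -> step_orth n S -> step_orth n (a *: Q + S).
Proof.
move=> [Q1 Q2] [S1 S2]; split=> k kn; rewrite mulrDl -scalerAl.
- by rewrite pintD // pintZ // Q1 // S1 // mulr0 addr0.
- by rewrite pintD // pintZ // Q2 // S2 // mulr0 addr0.
Qed.

Lemma step_orth_le (m n : nat) (Q : {poly R}) :
  (m <= n)%N -> step_orth n Q -> step_orth m Q.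
Proof.
move=> mn [Q1 Q2]; split=> k km.
- by apply: Q1; rewrite (leq_trans km) // uphalf_leq.
- by apply: Q2; rewrite (leq_trans km) // half_leq.
Qed.

(** Multiplication by ['X] costs one orthogonality condition per measure, hence two steps on the
    stepline. *)
Lemma step_orthXM (n : nat) (Q : {poly R}) :
  step_orth n.+2 Q -> step_orth n ('X * Q).
Proof.
by move=> [Q1 Q2]; split=> k kn; rewrite mulrAC -exprS mulrC ?Q1 ?Q2.
Qed.

Lemma uphalfD_half (n : nat) : (uphalf n + n./2)%N = n.
Proof. by rewrite uphalf_half -addnA addnn odd_double_half. Qed.

(** If nonzero, [Q] would be a type II polynomial, and normality would force its degree to be
    exactly [n]. *)
Lemma step_orth_eq0 (n : nat) (Q : {poly R}) :
  (size Q <= n)%N -> step_orth n Q -> Q = 0.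
Proof.
move=> sQ [Q1 Q2]; apply/eqP/negPn/negP => Q0.
have tQ : typeII mu1 mu2 (uphalf n) n./2 Q by split; rewrite // uphalfD_half leqW.
have [_ /(_ _ tQ) sz _] := hperf (uphalf n) n./2.
by move: sQ; rewrite sz uphalfD_half ltnn.
Qed.

Lemma stepP_spec (n : nat) :
  [/\ step_orth n (P n), P n \is monic & size (P n) = n.+1].
Proof.
have [[Q hQ _] sz _] := hperf (uphalf n) n./2.
have [] : [set Q | typeII mu1 mu2 (uphalf n) n./2 Q /\ Q \is monic] (P n).
  apply: xgetPex; exists ((lead_coef Q)^-1 *: Q).
  have [Q0 sQ Q1 Q2] := hQ.
  have l0 : (lead_coef Q)^-1 != 0 by rewrite invr_eq0 lead_coef_eq0.
  split; last by rewrite monicE lead_coefZ mulVf // lead_coef_eq0.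
  split.
  - by rewrite scaler_eq0 negb_or l0.
  - by rewrite size_scale.
  - by move=> k kn; rewrite -scalerAl pintZ // Q1 // mulr0.
  - by move=> k kn; rewrite -scalerAl pintZ // Q2 // mulr0.
move=> hP ?; split=> //; last by rewrite (sz _ hP) uphalfD_half.
by case: hP.
Qed.

Lemma stepP_monic (n : nat) : P n \is monic.
Proof. by case: (stepP_spec n). Qed.

Lemma size_stepP (n : nat) : size (P n) = n.+1.
Proof. by case: (stepP_spec n). Qed.

Lemma stepP_orth (n : nat) : step_orth n (P n).
Proof. by case: (stepP_spec n). Qed.

Lemma stepP0 : P 0 = 1.
Proof.
rewrite [LHS]size1_polyC ?size_stepP //.
by have /monicP := stepP_monic 0; rewrite lead_coefE size_stepP => ->.
Qed.

Lemma stepP1 : P 1 = 'X + ((P 1)`_0)%:P.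
Proof.
apply/polyP => i; rewrite coefD coefX coefC.
case: i => [|[|i]] /=; first by rewrite add0r.
- by have /monicP := stepP_monic 1; rewrite lead_coefE size_stepP addr0.
- by rewrite nth_default ?addr0 // size_stepP.
Qed.

(* Three coefficients kill the top three terms; what is left is still
   orthogonal at step n - 2, but has degree less than n - 2. *)
Lemma stepP_recurrence (n : nat) :
  'X * P n = P n.+1 + rec_b mu1 mu2 n *: P n
    + rec_c mu1 mu2 n *: stepP_back mu1 mu2 n 1
    + rec_d mu1 mu2 n *: stepP_back mu1 mu2 n 2.
Proof.
(* The coefficients are chosen by [xget], so exhibiting one valid triple suffices. *)
apply: (@xgetPex _ (0, 0, 0) [set bcd : R * R * R |
    'X * P n = P n.+1 + bcd.1.1 *: P n + bcd.1.2 *: stepP_back mu1 mu2 n 1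
               + bcd.2 *: stepP_back mu1 mu2 n 2]); rewrite /stepP_back.
pose Q0 := 'X * P n - P n.+1.
have sQ0 : (size Q0 <= n.+1)%N.
  have XPE : ('X * P n)`_n.+1 = 1.
    rewrite coefXM /=; have /monicP := stepP_monic n.
    by rewrite lead_coefE size_stepP.
  (* The factor 1 is written as the top coefficient of ['X * P n], giving the difference the form
     that [size_sub_monic] expects. *)
  rewrite /Q0 -[P n.+1]scale1r -{1}XPE.
  apply: size_sub_monic; rewrite ?stepP_monic ?size_stepP //.
  by rewrite mulrC size_mulX -?size_poly_eq0 size_stepP.
pose Q1 := Q0 - Q0`_n *: P n.
have sQ1 : (size Q1 <= n)%N by rewrite size_sub_monic ?stepP_monic ?size_stepP.
(* For [n] equal to 0 or 1 the degree bound alone forces the remainder to vanish, and the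
   coefficients of the absent terms are set to 0. From 2 on, orthogonality is needed. *)
case: n @Q0 @Q1 sQ0 sQ1 => [|[|n]] Q0 Q1 sQ0 sQ1.
- exists (Q0`_0, 0, 0) => /=; apply/eqP; rewrite !scale0r !addr0.
  by rewrite -subr_eq0 opprD addrA -/Q0 -/Q1 -size_poly_leq0.
- exists (Q0`_1, Q1`_0, 0) => /=; apply/eqP; rewrite scale0r addr0.
  rewrite -subr_eq0 !opprD !addrA -/Q0 -/Q1 -size_poly_leq0.
  by rewrite size_sub_monic ?stepP_monic ?size_stepP.
pose Q2 := Q1 - Q1`_n.+1 *: P n.+1.
have sQ2 : (size Q2 <= n.+1)%N.
  by rewrite size_sub_monic ?stepP_monic ?size_stepP.
exists (Q0`_n.+2, Q1`_n.+1, Q2`_n) => /=; rewrite !subSS !subn0; apply/eqP.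
rewrite -subr_eq0 !opprD !addrA -/Q0 -/Q1 -/Q2; apply/eqP.
apply: (@step_orth_eq0 n).
  by rewrite size_sub_monic ?stepP_monic ?size_stepP.
have low a m Q : (n <= m)%N -> step_orth n Q -> step_orth n (Q - a *: P m).
  move=> nm hQ; rewrite addrC -scaleNr; apply: step_orth_scale_add => //.
  exact: step_orth_le nm (stepP_orth m).
do 3! (apply: (low); first lia).
rewrite /Q0 -[P n.+3]scale1r; apply: (low); first lia.
exact: step_orthXM (stepP_orth _).
Qed.

(** * Integrals of stepline polynomials and the type I constants *)

Lemma pint1_stepP (k : nat) : (0 < k)%N -> L1 (P k) = 0.
Proof.
by move=> k0; have [/(_ 0) + _] := stepP_orth k; rewrite mulr1; apply; case: k k0.
Qed.

Lemma pint2_stepP (k : nat) : (1 < k)%N -> L2 (P k) = 0.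
Proof.
by move=> k0; have [_ /(_ 0)] := stepP_orth k; rewrite mulr1; apply;
  case: k k0 => [|[]].
Qed.

(** Otherwise the constant 1, of degree 0, would satisfy the orthogonality of step 1, against
    normality at (1,0). *)
Lemma pint1_1_neq0 : L1 1 != 0.
Proof.
apply: contraTneq isT => L0; have /eqP := oner_neq0 {poly R}; case.
apply: (@step_orth_eq0 1); first by rewrite size_poly1.
by split=> [[|k]|k] //; rewrite mulr1.
Qed.

(** Otherwise [P 1], of degree 1, would satisfy the orthogonality of step 2, against normality at
    (1,1). *)
Lemma pint2_stepP1_neq0 : L2 (P 1) != 0.
Proof.
apply: contraTneq isT => L0; have /eqP := monic_neq0 (stepP_monic 1); case.
apply: (@step_orth_eq0 2); first by rewrite size_stepP.
by split=> [[|k]|[|k]] // _; rewrite mulr1 // pint1_stepP.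
Qed.

Definition typeI_norm (n m : nat) (AB : {poly R} * {poly R}) : R :=
  L1 ('X^((n + m).-1) * AB.1) + L2 ('X^((n + m).-1) * AB.2).

(** Any type I pair is rescaled by the inverse of its [typeI_norm]. That this is nonzero is left as
    a premise, checked below at (1,0) and (1,1), where the polynomials are constants. *)
Lemma typeI_polys_spec (n m : nat) : (0 < n + m)%N ->
  (forall AB, typeI mu1 mu2 n m AB -> typeI_norm n m AB != 0) ->
  typeI mu1 mu2 n m (typeI_polys mu1 mu2 n m) /\
  typeI_norm n m (typeI_polys mu1 mu2 n m) = 1.
Proof.
move=> nm s0; have [_ _ /(_ nm)[AB hAB _]] := hperf n m.
have {}s0 := s0 _ hAB; pose a := (typeI_norm n m AB)^-1.
have a0 : a != 0 by rewrite invr_eq0.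
apply: (@xgetPex _ (0, 0)
  [set AB | typeI mu1 mu2 n m AB /\ typeI_norm n m AB = 1]).
exists (a *: AB.1, a *: AB.2); split.
  have [AB0 sA sB orth] := hAB; split => /=.
  - apply: contra AB0 => /eqP[/eqP + /eqP]; rewrite !scaler_eq0 (negPf a0) /=.
    by case: AB {s0 a a0 hAB sA sB orth} => A B /= /eqP-> /eqP->.
  - by rewrite size_scale.
  - by rewrite size_scale.
  - by move=> k kn; rewrite -!scalerAl !pintZ // -mulrDr orth // mulr0.
by rewrite /typeI_norm /= -!scalerAr !pintZ // -mulrDr mulVf.
Qed.

Lemma stepA1_spec : (stepA mu1 mu2 1)`_0 * L1 1 = 1.
Proof.
have cst AB : typeI mu1 mu2 1 0 AB ->
    typeI_norm 1 0 AB = AB.1`_0 * L1 1 /\ AB.1`_0 != 0.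
  case: AB => A B [/= AB0 sA + _]; rewrite size_poly_leq0 => /eqP B0.
  rewrite /typeI_norm /= B0 mulr0 pint0 // addr0 mul1r.
  split; first by rewrite {1}(size1_polyC sA) -alg_polyC pintZ.
  by apply: contra AB0 => /eqP A0; rewrite (size1_polyC sA) A0 B0.
have [AB|hAB s1] := @typeI_polys_spec 1 0 isT.
  by move=> /cst[-> A0]; rewrite mulf_neq0 // pint1_1_neq0.
by rewrite -s1; have [-> _] := cst _ hAB.
Qed.

(** In the normalization, ['X] is replaced by [P 1] minus its constant term: the constant
    contributes a multiple of the orthogonality relation, and [L1 (P 1)] is 0, so only the
    [L2 (P 1)] term remains. *)
Lemma stepAB2_spec :
  (stepA mu1 mu2 2)`_0 * L1 1 + (stepB mu1 mu2 2)`_0 * L2 1 = 0 /\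
  (stepB mu1 mu2 2)`_0 * L2 (P 1) = 1.
Proof.
have cst AB : typeI mu1 mu2 1 1 AB ->
    [/\ typeI_norm 1 1 AB = AB.2`_0 * L2 (P 1),
        AB.1`_0 * L1 1 + AB.2`_0 * L2 1 = 0 & AB.2`_0 != 0].
  case: AB => A B [/= AB0 sA sB /(_ 0 isT)]; rewrite !mulr1.
  have cE (Q : {poly R}) S : (size Q <= 1)%N -> S * Q = Q`_0 *: S.
    by move=> /size1_polyC {1}->; rewrite mulrC mul_polyC.
  rewrite -[X in L1 X]mul1r -[X in L2 X]mul1r !cE // !pintZ // => orth.
  split=> //.
    have := pint1_stepP (ltn0Sn 0); rewrite /typeI_norm /= expr1 !(cE _ 'X) //.
    rewrite !pintZ // stepP1 -alg_polyC !pintD // !pintZ // => LX.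
    have -> : L1 'X = - ((P 1)`_0 * L1 1) by apply/eqP; rewrite -addr_eq0 LX.
    have aL1 : A`_0 * L1 1 = - (B`_0 * L2 1) by apply/eqP; rewrite -addr_eq0 orth.
        by rewrite mulrN mulrCA aL1; ring.
  apply: contra AB0 => /eqP B0; move: orth; rewrite B0 mul0r addr0 => /eqP.
  rewrite mulf_eq0 (negPf pint1_1_neq0) orbF => /eqP A0.
  by rewrite (size1_polyC sA) (size1_polyC sB) A0 B0.
have [AB|hAB s1] := @typeI_polys_spec 1 1 isT.
  by move=> /cst[-> _ B0]; rewrite mulf_neq0 // pint2_stepP1_neq0.
by have [s orth _] := cst _ hAB; split=> //; rewrite -s1 s.
Qed.

(** The relations for the type I constants say, entry by entry, that [typeI_mx] times this matrix of
    integrals is the identity. *)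
Lemma typeI_mx_inv :
  typeI_mx mu1 mu2 \in unitmx /\
  invmx (typeI_mx mu1 mu2) = \matrix_(i < 2, j < 2)
    if i == 0 then (if j == 0 then L1 1 else 0)
    else (if j == 0 then L2 1 else L2 (P 1)).
Proof.
set M := \matrix_(i, j) _.
have [orth B2] := stepAB2_spec.
have TM : typeI_mx mu1 mu2 *m M = 1%:M.
  apply/matrixP => i j; rewrite mxE !big_ord_recl big_ord0 !mxE /= addr0.
  case: i => [[|[|//]]] i2; case: j => [[|[|//]]] j2 /=.
  - by rewrite mul0r addr0 stepA1_spec.
  - by rewrite mulr0 mul0r addr0.
  - exact: orth.
  - by rewrite mulr0 add0r.
have [Tu _] := mulmx1_unit TM; split=> //.
by rewrite -[LHS]mulmx1 -TM mulKmx.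
Qed.

(** * The Hessenberg matrix acting on values of stepline polynomials *)

Lemma toC_stepP_recurrence (n : nat) (z : R[i]) :
  z * (toC_poly (P n)).[z] = (toC_poly (P n.+1)).[z]
    + (rec_b mu1 mu2 n)%:C * (toC_poly (P n)).[z]
    + (rec_c mu1 mu2 n)%:C * (toC_poly (stepP_back mu1 mu2 n 1)).[z]
    + (rec_d mu1 mu2 n)%:C * (toC_poly (stepP_back mu1 mu2 n 2)).[z].
Proof.
have := congr1 (fun Q => (toC_poly Q).[z]) (stepP_recurrence n).
by rewrite /toC_poly !rmorphD rmorphM /= !map_polyZ map_polyX !hornerE.
Qed.

(** Each term of the recurrence becomes a sum over the whole row weighted by a Kronecker delta; the
    two sides are then compared entry by entry. *)
Lemma hessenberg_stepP (N : nat) (z : R[i]) (i : 'I_N) :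
  (toC_poly (P N)).[z] = 0 ->
  \sum_(k < N) (hessenberg mu1 mu2 N i k)%:C * (toC_poly (P k)).[z] =
  z * (toC_poly (P i)).[z].
Proof.
move=> PN0; rewrite toC_stepP_recurrence.
have pick (m : nat) : \sum_(k < N) (m == k)%:R * (toC_poly (P k)).[z] =
    if (m < N)%N then (toC_poly (P m)).[z] else 0.
  case: ltnP => mN.
    rewrite (bigD1 (Ordinal mN)) //=. rewrite eqxx mul1r big1 ?addr0 // => k.
    by rewrite -val_eqE /= eq_sym => /negPf->; rewrite mul0r.
  by apply: big1 => k _; rewrite gtn_eqF ?mul0r // (leq_trans _ mN).
(* The delta selects [k = i - m]; when [i < m] no index qualifies, matching the zero convention of
   [stepP_back]. *)
have back (m : nat) : \sum_(k < N) ((i : nat) == (k + m)%N)%:R * (toC_poly (P k)).[z] =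
    (toC_poly (stepP_back mu1 mu2 i m)).[z].
  rewrite /stepP_back; case: leqP => mi.
    rewrite -[RHS](ifT (b := (i - m < N)%N) _ 0); last by have := ltn_ord i; lia.
    rewrite -pick; apply: eq_bigr => k _; congr (_%:R * _); lia.
  rewrite /toC_poly rmorph0 horner0; apply: big1 => k _.
  by rewrite ltn_eqF ?mul0r //; lia.
(* In the last row no column has index [i.+1 = N], so the sum is 0; this is where [z] must be a zero
   of [P N]. *)
have -> : (toC_poly (P i.+1)).[z] = \sum_(k < N) (i.+1 == k)%:R * (toC_poly (P k)).[z].
  rewrite pick; case: ltnP => // Ni.
  by have -> : i.+1 = N by apply/eqP; rewrite eqn_leq ltn_ord.
have -> : (toC_poly (P i)).[z] =
    \sum_(k < N) ((i : nat) == k)%:R * (toC_poly (P k)).[z].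
  by rewrite pick ltn_ord.
rewrite -!back !mulr_sumr -!big_split; apply: eq_bigr => k _ /=.
rewrite mxE !mulrA -!mulrDl; congr (_ * _); rewrite addn1 addn2 [k == i :> nat]eq_sym.
rewrite [k == i.+1 :> nat]eq_sym.
(* The four bands are disjoint: where one test succeeds, the other deltas vanish. *)
do 3 ! [case: eqP => ?; first by
  do ! (rewrite (_ : (_ == _ :> nat) = false); last lia);
  rewrite ?mulr1 ?mulr0 ?addr0 ?add0r].
by case: eqP => _; rewrite ?mulr1 ?mulr0 ?addr0 ?add0r.
Qed.
End Stepline.

(** * Quadrature weights from eigenvectors *)

Lemma quad_weightE (R : realType) (mu : {measure set (measurableTypeR R) -> \bar R})
    (hmom : finite_moments mu) (n : nat) (c : 'I_n -> R[i]) (p : 'I_n -> {poly R})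
    (Q : {poly R[i]}) (z : R[i]) :
  (Q^`().[z])^-1 *: (Q %/ ('X - z%:P)) = \sum_(k < n) c k *: toC_poly (p k) ->
  quad_weight mu Q z = \sum_(k < n) c k * (pint mu (p k))%:C.
Proof.
move=> QE; rewrite -cintegral_toC_sum // -QE /quad_weight; congr cintegral.
by apply/funext => t; rewrite hornerZ mulrC.
Qed.

Theorem theorem2 (R : realType)
    (mu1 mu2 : {measure set (measurableTypeR R) -> \bar R})
    (hmom1 : finite_moments mu1) (hmom2 : finite_moments mu2)
    (hperf : perfect mu1 mu2)
    (N : nat) (hN : (2 <= N)%N)
    (x : 'I_N -> R[i])
    (hx : toC_poly (stepP mu1 mu2 N) = \prod_(j < N) ('X - (x j)%:P))
    (hdist : injective x) :
  let PN : {poly R[i]} := toC_poly (stepP mu1 mu2 N) in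
  let H : 'M[R[i]]_N := map_mx (real_complex R) (hessenberg mu1 mu2 N) in
  let D : 'M[R]_2 := invmx (typeI_mx mu1 mu2) in
  let k1 : 'I_N := Ordinal (ltnW hN) in
  let k2 : 'I_N := Ordinal hN in
  [/\ forall z : R[i], eigenvalue H z <-> exists j : 'I_N, z = x j,
      typeI_mx mu1 mu2 \in unitmx
    & forall j : 'I_N,
        (exists! v : 'cV[R[i]]_N, right_eigenvector H (x j) v /\ v k1 0 = 1) /\
        forall (v : 'cV[R[i]]_N) (u : 'rV[R[i]]_N),
          right_eigenvector H (x j) v -> v k1 0 = 1 ->
          left_eigenvector H (x j) u ->
          [/\ pairing u v != 0,
              quad_weight mu1 PN (x j)
                = (D 0 0)%:C * u 0 k1 / pairing u v
            & quad_weight mu2 PN (x j)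
                = ((D 1 0)%:C * u 0 k1 + (D 1 1)%:C * u 0 k2) / pairing u v]].
Proof.
move=> PN H D k1 k2.
have PN0 j : PN.[x j] = 0.
  by rewrite /PN hx horner_prod (bigD1 j) //= hornerXsubC subrr mul0r.
pose V : 'M[R[i]]_N := \matrix_(k, j) (toC_poly (stepP mu1 mu2 k)).[x j].
have HV i j : (H *m V) i j = x j * V i j.
  rewrite mxE [V i j]mxE -(hessenberg_stepP hmom1 hmom2 hperf i (PN0 j)).
  by apply: eq_bigr => k _; rewrite !mxE.
pose l j := (PN^`().[x j])^-1 *: (PN %/ ('X - (x j)%:P)).
have /choice[C lE] j : exists c : 'I_N -> R[i],
    l j = \sum_(k < N) c k *: toC_poly (stepP mu1 mu2 k).
  apply: (monic_expansion (P := fun k => toC_poly (stepP mu1 mu2 k))) => [k|].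
    by rewrite map_monic size_map_poly stepP_monic // size_stepP.
  exact: leq_trans (size_scale_leq _ _) (lagrange_size hx j).
pose CM : 'M[R[i]]_N := \matrix_(j, k) C j k.
have CV : CM *m V = 1%:M.
  apply/matrixP => j i; rewrite !mxE eq_sym -(lagrange_horner hx hdist i j).
  (* Entry [(j, i)] of the product is the Lagrange polynomial [l j] evaluated at [x i]. *)
  transitivity (l j).[x i]; last by rewrite hornerZ mulrC.
  by rewrite lE horner_sum; apply: eq_bigr => k _; rewrite !mxE hornerZ.
have [Tu TE] := typeI_mx_inv hmom1 hmom2 hperf.
split=> //; first by move=> z; exact: diagonalized_eigenvalue CV HV z.
have V1 j : V k1 j = 1 by rewrite mxE stepP0 // /toC_poly rmorph1 hornerC.
move=> j; have Hcol : H *m col j V = x j *: col j V.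
  rewrite colE mulmxA -!colE; apply/colP => i.
  by rewrite [LHS]mxE HV [RHS]mxE [X in _ = _ * X]mxE.
(* An eigenvector is a multiple of column [j] of [V], whose first entry is 1 because [P 0] is 1; the
   normalization fixes the multiple. *)
have vE v : right_eigenvector H (x j) v -> v k1 0 = 1 -> v = col j V.
  move=> [/(right_eigen_col hdist CV HV) e _]; rewrite e V1 mul1r => cv1.
  by apply/colP => k; rewrite e cv1 mulr1 [RHS]mxE.
split.
  exists (col j V); split; last by move=> v [hv v1]; rewrite (vE v hv v1).
  split; last by rewrite [LHS]mxE V1.
  split=> //; apply/eqP => /colP/(_ k1)/eqP.
  by rewrite [col j V k1 0]mxE V1 mxE oner_eq0.
move=> v u hv v1 [hu u0]; rewrite {v hv v1}(vE v hv v1).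
have uE k : u 0 k = (u *m V) 0 j * C j k.
  by rewrite (left_eigen_row hdist CV HV hu) [CM j k]mxE.
have pE : pairing u (col j V) = (u *m V) 0 j.
  by rewrite mxE; apply: eq_bigr => k _; rewrite mxE.
(* Every component of [u] is a multiple of this scalar, so its vanishing would make [u] zero. *)
rewrite pE; have p0 : (u *m V) 0 j != 0.
  apply: contra u0 => /eqP p0; apply/eqP/rowP => k.
  by rewrite uE p0 mul0r mxE.
have [D00 D10 D11] : [/\ D 0 0 = pint mu1 1, D 1 0 = pint mu2 1
    & D 1 1 = pint mu2 (stepP mu1 mu2 1)] by rewrite /D TE !mxE.
split=> //.
- rewrite (quad_weightE hmom1 (lE j)) (bigD1 k1) //= big1 ?addr0 => [|k].
    by rewrite uE D00 stepP0 // mulrCA [RHS]mulrC mulKf // mulrC.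
  by rewrite -val_eqE /= -lt0n => k0; rewrite pint1_stepP // mulr0.
- rewrite (quad_weightE hmom2 (lE j)) (bigD1 k1) //= (bigD1 k2) //= big1 ?addr0 => [|k].
    rewrite !uE D10 D11 stepP0 //; apply: (mulIf p0); rewrite divfK //; ring.
  rewrite -!val_eqE /= => /andP[k0 k10]; rewrite pint2_stepP ?mulr0 //; lia.
Qed.
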